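(* Let $G$ be a finite simple connected graph of class two, i.e. $\chi'(G)=\Delta(G)+1$. Then every proper edge colouring $w$ of $G$ (with any number of colours) is sequentially orderable, i.e. there is a total order $\prec$ on $E(G)$ such that $f_{\prec}(u)\neq f_{\prec}(v)$ for every edge $uv\in E(G)$.
   Context: An edge colouring (edge weighting) is a map $w:E(G)\to\mathcal C$ into an arbitrary set $\mathcal C$ of colours; it is proper if any two distinct edges sharing an endpoint receive distinct colours. $\chi'(G)$ is the chromatic index (least number of colours in a proper edge colouring of $G$) and $\Delta(G)$ is the maximum degree; $G$ is of class two if $\chi'(G)=\Delta(G)+1$. Given a total order $\prec$ on $E(G)$, the vertex colouring induced by $w$ and $\prec$ assigns to each vertex $v$ of degree $d(v)$ the finite sequence $f_{\prec}(v)=(w(e_1),\dots,w(e_{d(v)}))$, where $e_1\prec\dots\prec e_{d(v)}$ are all the edges incident with $v$. The colouring $w$ is called sequentially orderable if there is a total order $\prec$ on $E(G)$ for which $f_{\prec}$ is a proper vertex colouring, i.e. $f_{\prec}(u)\ne f_{\prec}(v)$ for all adjacent $u,v$ (sequences of different lengths are different). *)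

(* Defs.v *)
From HB Require Import structures.
From mathcomp Require Import all_boot.

Set Implicit Arguments.
Unset Strict Implicit.
Unset Printing Implicit Defensive.

Record sgraph := SGraph {
  vertex :> finType;
  adj : rel vertex;
  adj_sym : symmetric adj;
  adj_irrefl : irreflexive adj
}.

Definition connected (G : sgraph) : Prop :=
  forall x y : G, connect (@adj G) x y.

Definition degree (G : sgraph) (v : G) : nat := #|[set u : G | adj v u]|.

Definition max_degree (G : sgraph) : nat := \max_(v : G) degree v.

Definition edges (G : sgraph) : {set {set G}} :=
  [set [set x; y] | x in [set: G], y in [set z : G | adj x z]].

(* The edge set E(G) as a type, so that colourings and orders have exactly
   E(G) as their domain. *)
Definition edge (G : sgraph) : predArgType := {a : {set G} | a \in edges G}.

HB.instance Definition _ (G : sgraph) := SubFinite.on (edge G).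

Definition incident (G : sgraph) (v : G) (a : edge G) : bool := v \in val a.

Definition share_endpoint (G : sgraph) (a b : edge G) : bool :=
  [exists v : G, incident v a && incident v b].

Definition proper_edge_colouring (G : sgraph) (C : Type) (w : edge G -> C) :
    Prop :=
  forall a b : edge G, a != b -> share_endpoint a b -> w a <> w b.

Definition edge_colourable (G : sgraph) (k : nat) : bool :=
  [exists w : {ffun edge G -> 'I_k},
    [forall a : edge G, forall b : edge G,
      (a != b) ==> share_endpoint a b ==> (w a != w b)]].

Lemma edge_colourableP (G : sgraph) (k : nat) :
  reflect (exists w : edge G -> 'I_k, proper_edge_colouring w)
          (edge_colourable G k).
Proof.
apply: (iffP existsP) => [[w /forallP wP]|[w wP]].
  exists w => a b ab sab; apply/eqP.
  by move/forallP: (wP a) => /(_ b); rewrite ab sab.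
exists (finfun w); apply/forallP => a; apply/forallP => b.
apply/implyP => ab; apply/implyP => sab; rewrite !ffunE.
by apply/eqP; apply: wP.
Qed.

Lemma edge_colourable_exists (G : sgraph) : exists k, edge_colourable G k.
Proof.
exists #|{: edge G}|; apply/edge_colourableP; exists enum_rank => a b /eqP ab _.
by move/enum_rank_inj.
Qed.

Definition chromatic_index (G : sgraph) : nat :=
  ex_minn (edge_colourable_exists G).

Definition class_two (G : sgraph) : Prop :=
  chromatic_index G = (max_degree G).+1.

Definition total_order (E : Type) (le : rel E) : Prop :=
  [/\ reflexive le, antisymmetric le, transitive le & total le].

(* For a total order [le] there is exactly one [le]-increasing list of the
   edges at [v], and [sort] returns it. *)
Definition induced_colour (G : sgraph) (C : Type) (w : edge G -> C)
    (le : rel (edge G)) (v : G) : seq C :=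
  [seq w a | a <- sort le (enum [set a : edge G | incident v a])].

Definition proper_vertex_colouring (G : sgraph) (D : Type) (f : G -> D) :
    Prop :=
  forall u v : G, adj u v -> f u <> f v.

Definition sequentially_orderable (G : sgraph) (C : Type) (w : edge G -> C) :
    Prop :=
  exists2 le : rel (edge G),
    total_order le & proper_vertex_colouring (induced_colour w le).

(* Main.v *)
Require Import Defs.
From mathcomp Require Import all_boot zify.
From Stdlib Require Import Classical.

(** Insert the edges one at a time at the end of the order.  If the initial
    segments of f(u) and f(v) differ just before an edge uv is inserted, then
    f(u) and f(v) stay different for ever: as w is proper, w(uv) occurs once in
    each of them.  The same holds if the colour sets at u and v differ.  So it
    suffices to insert only such "separating" edges, which requires that one is
    always left.  Class two gives the first one: G is connected, and if all
    colour sets were equal then Delta(G) colours would suffice.  We keep the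
    remaining edges connected, and keep out of two kinds of dead ends: those
    where all remaining vertices look alike, and the two-coloured paths and
    cycles of [trap] below.  Inserting a separating edge that is not a bridge is
    always safe.  If all separating edges are bridges, then by parity (a
    remaining colour that is present at all vertices of X and does not leave X
    matches X perfectly) one of them is pendant; if removing it leads to a dead
    end, then a second pendant edge exists, and removing that one is safe. *)

Set Implicit Arguments.
Unset Strict Implicit.
Unset Printing Implicit Defensive.

(** * Partial edge orders: labels, cuts, dead ends *)

Section EdgeInsertion.

Variables (V E C : finType) (p q : E -> V) (w : E -> C).
Hypothesis neq_ends : forall e, p e != q e.

Definition inc (v : V) (e : E) : bool := (v == p e) || (v == q e).

Hypothesis w_proper : forall v e f, inc v e -> inc v f -> w e = w f -> e = f.

Definition other (e : E) (v : V) : V := if v == p e then q e else p e.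

Definition cross (X : {set V}) (e : E) : bool := (p e \in X) (+) (q e \in X).

Definition label (s : seq E) (v : V) : seq C := [seq w e | e <- s & inc v e].

Definition palette (v : V) : {set C} := w @: [set e | inc v e].

Definition state (s : seq E) (v : V) : {set C} * seq C := (palette v, label s v).

Definition remaining (s : seq E) (v : V) : {set E} :=
  [set e | (e \notin s) && inc v e].

Definition live (s : seq E) (v : V) : bool := remaining s v != set0.

Definition separating (s : seq E) (e : E) : bool :=
  state s (p e) != state s (q e).

(** Stated by vertex cuts rather than paths, like [bridge], so that every use only has to exhibit
    one set. *)
Definition link_connected (s : seq E) : Prop :=
  forall X : {set V}, (forall e, e \notin s -> ~~ cross X e) ->
  forall u v, live s u -> live s v -> u \in X -> v \in X.

Definition bridge (s : seq E) (e : E) : Prop :=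
  exists X : {set V}, cross X e /\
    forall f, f \notin s -> f != e -> ~~ cross X f.

Definition uniform (s : seq E) : Prop :=
  forall u v, live s u -> live s v -> state s u = state s v.

(* Up to two further colours [c], [t] are missing after a common prefix [sg], so
   a connected trap is a path or a cycle whose final sequences can only be
   [sg ++ [:: c; t]] and [sg ++ [:: t; c]].  Truncated subtraction makes the
   prefix empty for one-element palettes. *)
Definition trap (s : seq E) : Prop :=
  forall u v, live s u -> live s v ->
  [/\ palette u = palette v, #|palette u| <= (size (label s u)).+2 &
      take (#|palette v| - 2) (label s u) =
      take (#|palette v| - 2) (label s v)].

(** * Endpoints, labels and palettes *)

Lemma inc_p e : inc (p e) e. Proof. by rewrite /inc eqxx. Qed.

Lemma inc_q e : inc (q e) e. Proof. by rewrite /inc eqxx orbT. Qed.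

Lemma inc_other v e : inc (other e v) e.
Proof. by rewrite /other; case: ifP; rewrite ?inc_p ?inc_q. Qed.

Lemma other_neq v e : inc v e -> other e v != v.
Proof.
rewrite /inc /other; case: (v =P p e) => [-> _|_ /= /eqP ->] //.
by rewrite eq_sym.
Qed.

Lemma incE v e x : inc v e -> inc x e = (x == v) || (x == other e v).
Proof.
rewrite /inc /other; case: (v =P p e) => [-> _|_ /= /eqP ->] //.
by rewrite orbC.
Qed.

Lemma crossE v e X : inc v e -> cross X e = (v \in X) (+) (other e v \in X).
Proof.
rewrite /inc /other /cross; case: (v =P p e) => [-> _|_ /= /eqP ->] //.
by rewrite addbC.
Qed.

Lemma separatingE s v e : inc v e ->
  separating s e = (state s v != state s (other e v)).
Proof.
rewrite /inc /other /separating; case: (v =P p e) => [-> _|_ /= /eqP ->] //.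
by rewrite eq_sym.
Qed.

Lemma cross_setC X e : cross (~: X) e = cross X e.
Proof. by rewrite /cross !inE; case: (p e \in X); case: (q e \in X). Qed.

Lemma crossP X e : cross X e ->
  exists u, [/\ inc u e, u \in X & other e u \notin X].
Proof.
move=> c; case pX: (p e \in X).
  exists (p e); rewrite inc_p pX; split=> //.
  by move: c; rewrite (crossE _ (inc_p e)) pX.
exists (q e); rewrite inc_q; move: c; rewrite (crossE _ (inc_q e)).
have -> : other e (q e) = p e.
  by rewrite /other eq_sym (negbTE (neq_ends e)).
by rewrite pX addbF.
Qed.

Lemma liveP s v : reflect (exists2 e, e \notin s & inc v e) (live s v).
Proof.
apply: (iffP (set0Pn _)) => [[e]|[e es ve]].
  by rewrite inE => /andP[]; exists e.
by exists e; rewrite inE es.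
Qed.

Lemma live_inc s v e : e \notin s -> inc v e -> live s v.
Proof. by move=> es ve; apply/liveP; exists e. Qed.

Lemma live_rcons s v e : live (rcons s e) v -> live s v.
Proof.
case/liveP=> f; rewrite mem_rcons inE negb_or => /andP[_ fs] vf.
exact: live_inc vf.
Qed.

Lemma label_rcons s e v :
  label (rcons s e) v = if inc v e then rcons (label s v) (w e) else label s v.
Proof. by rewrite /label filter_rcons; case: ifP; rewrite ?map_rcons. Qed.

Lemma label_rcons_other s e u x : inc u e -> x != u -> x != other e u ->
  label (rcons s e) x = label s x.
Proof.
by move=> ue xu xo; rewrite label_rcons (incE x ue) (negbTE xu) (negbTE xo).
Qed.

Lemma notin_label s e v : e \notin s -> inc v e -> w e \notin label s v.
Proof.
move=> es ve; apply/mapP => [[f]]; rewrite mem_filter => /andP[vf fs].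
by move/(w_proper ve vf) => ef; rewrite ef fs in es.
Qed.

Lemma card_palette s v : uniq s ->
  #|palette v| = size (label s v) + #|remaining s v|.
Proof.
move=> us; rewrite card_in_imset; last first.
  by move=> e f; rewrite !inE; apply: w_proper.
rewrite size_map -(card_uniqP (filter_uniq _ us)) -cardUI.
rewrite [X in _ = _ + X](_ : _ = 0) ?addn0; last first.
  apply: eq_card0 => e; rewrite !inE mem_filter.
  by case: (e \in s); rewrite ?andbF.
apply: eq_card => e; rewrite !inE mem_filter.
by case: (e \in s); case: (inc v e).
Qed.

Lemma live_size s v : uniq s -> live s v = (size (label s v) < #|palette v|).
Proof. by move=> us; rewrite (card_palette v us) /live -card_gt0; lia. Qed.

Lemma size_leaf s v e : uniq s -> e \notin s -> inc v e ->
  (forall f, f \notin s -> inc v f -> f = e) ->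
  #|palette v| = (size (label s v)).+1.
Proof.
move=> us es ve only; rewrite (card_palette v us).
suff -> : remaining s v = [set e] by rewrite cards1 addn1.
apply/setP => f; rewrite !inE; apply/andP/eqP => [[]|-> //].
exact: only.
Qed.

Lemma leaf_size s v e : uniq s -> e \notin s -> inc v e ->
  #|palette v| = (size (label s v)).+1 ->
  forall f, f \notin s -> inc v f -> f = e.
Proof.
move=> us es ve; rewrite (card_palette v us) => sz f fs vf.
have /eqP/cards1P[g rg] : #|remaining s v| = 1 by lia.
have : e \in remaining s v by rewrite inE es.
have : f \in remaining s v by rewrite inE fs.
by rewrite rg !inE => /eqP -> /eqP.
Qed.

(** * Free colours and parity *)

Definition free_colours s v : {set C} := w @: remaining s v.

Lemma free_coloursE s v :
  free_colours s v = [set c in palette v | c \notin label s v].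
Proof.
apply/setP => c; rewrite inE; apply/imsetP/andP.
  case=> e; rewrite inE => /andP[es ve] ->; split; last exact: notin_label.
  by apply/imsetP; exists e; rewrite ?inE.
case=> /imsetP[e]; rewrite inE => ve -> cl; exists e => //.
rewrite inE ve andbT; apply: contra cl => es.
by apply/mapP; exists e; rewrite // mem_filter ve.
Qed.

Lemma state_free s u v : state s u = state s v ->
  free_colours s u = free_colours s v.
Proof. by rewrite !free_coloursE => -[-> ->]. Qed.

(** Each vertex of [X] lies on exactly one remaining edge of colour [t]. Such edges inside [X]
    account for its vertices in pairs, so only the crossing ones affect the parity. *)
Lemma odd_card_cross s (X : {set V}) t :
  (forall x, x \in X -> t \in free_colours s x) ->
  odd #|X| = \big[addb/false]_(e | (e \notin s) && (w e == t)) cross X e.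
Proof.
move=> Xt.
have -> : #|X| =
  \sum_(e | (e \notin s) && (w e == t)) ((p e \in X) + (q e \in X)).
  rewrite -sum1_card.
  transitivity (\sum_(x in X) \sum_(e | (e \notin s) && (w e == t)) inc x e).
    apply: eq_bigr => x /Xt /imsetP[e]; rewrite inE => /andP[es xe] te.
    rewrite (bigD1 e) ?es ?te //= xe big1 ?addn0 // => f /andP[/andP[_ tf] fe].
    case xf: (inc x f) => //; case/eqP: fe.
    by apply: w_proper xf xe _; apply/eqP.
  rewrite exchange_big; apply: eq_bigr => e _ /=.
  have sumb (a : V) : \sum_(x in X) (x == a) = (a \in X) :> nat.
    rewrite big_mkcond (bigD1 a) //= eqxx big1 ?addn0.
      by case: (a \in X).
    by move=> x /negbTE ->; case: ifP.
  rewrite -!sumb -big_split; apply: eq_bigr => x _ /=; rewrite /inc.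
  case: (x =P p e) => [->|_] //=; first by rewrite (negbTE (neq_ends e)).
elim/big_rec2: _ => // e m b _ IH.
by rewrite oddD IH /cross oddD; case: (p e \in X); case: (q e \in X).
Qed.

(** A second remaining edge [f] at [u] would have another colour. Both colours are free throughout
    [X], but parity makes [#|X|] odd by the colour of [e] and even by that of [f], which no crossing
    edge has. *)
Lemma unique_cross_leaf s (X : {set V}) e u :
  (forall x y, x \in X -> y \in X -> free_colours s x = free_colours s y) ->
  e \notin s -> cross X e ->
  (forall f, f \notin s -> f != e -> ~~ cross X f) ->
  u \in X -> inc u e -> forall f, f \notin s -> inc u f -> f = e.
Proof.
move=> Xfree es Xe Xf uX ue f fs uf; apply/eqP; apply: contraT => fe.
have mem g : g \notin s -> inc u g ->
    forall x, x \in X -> w g \in free_colours s x.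
  move=> gs ug x xX; rewrite (Xfree _ _ xX uX).
  by apply/imsetP; exists g; rewrite // inE gs.
have := odd_card_cross (mem f fs uf).
rewrite (odd_card_cross (mem e es ue)) (bigD1 e) ?es ?eqxx //= Xe.
rewrite big1; last by move=> g /andP[/andP[gs _]] ge; apply/negbTE/Xf.
rewrite big1 // => g /andP[gs wg]; apply/negbTE/Xf => //.
apply: contra fe => /eqP ge; rewrite ge eq_sym in wg.
exact/eqP/(w_proper uf ue)/eqP.
Qed.

(** * Separating edges, bridges and leaves *)

Lemma ex_separating s : link_connected s -> ~ uniform s ->
  exists2 e, e \notin s & separating s e.
Proof.
move=> conn nu; apply: NNPP => none; apply: nu => u v lu lv.
apply/esym/eqP.
(* If no remaining edge separates, none crosses the class of vertices with the state of [u]. *)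
suff: v \in [set x | state s x == state s u] by rewrite inE.
apply: (conn _ _ u v) => //; last by rewrite inE.
move=> e es; apply/negP => c; apply: none; exists e => //.
by apply: contraL c => /eqP pq; rewrite /cross !inE pq addbb.
Qed.

Lemma link_connected_rcons_nonbridge s e :
  link_connected s -> ~ bridge s e -> link_connected (rcons s e).
Proof.
move=> conn nb X Xf u v /live_rcons lu /live_rcons lv; apply: conn => // f fs.
case: (f =P e) => [->|/eqP fe]; last by apply: Xf; rewrite mem_rcons inE negb_or fe.
apply/negP => Xe; apply: nb; exists X; split=> // g gs ge.
by apply: Xf; rewrite mem_rcons inE negb_or ge.
Qed.

(* If only the pendant edge [e] crosses [X], moving its leaf [u] to the other
   side of [X] leaves no crossing edge. *)
Lemma link_connected_rcons_leaf s e u :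
  link_connected s -> e \notin s -> inc u e ->
  (forall f, f \notin s -> inc u f -> f = e) -> link_connected (rcons s e).
Proof.
move=> conn es ue only X Xf a b la lb.
have Xf' f : f \notin s -> f != e -> ~~ cross X f.
  by move=> fs fe; apply: Xf; rewrite mem_rcons inE negb_or fe.
case Xe: (cross X e); last first.
  apply: conn (live_rcons la) (live_rcons lb) => f fs.
  by case: (f =P e) => [->|/eqP /Xf' ->] //; rewrite Xe.
have live_neq x : live (rcons s e) x -> x != u.
  case/liveP=> f; rewrite mem_rcons inE negb_or => /andP[fe fs] xf.
  by apply: contraNneq fe => xu; rewrite (only f) // -xu.
pose Z := [set x | (x \in X) (+) (x == u)].
have ZE x : x != u -> (x \in Z) = (x \in X).
  by move=> xu; rewrite inE (negbTE xu) addbF.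
rewrite -(ZE a) ?live_neq // -(ZE b) ?live_neq //.
apply: conn (live_rcons la) (live_rcons lb) => f fs.
case uf: (inc u f).
  rewrite (only f fs uf) (crossE _ ue) !inE eqxx (negbTE (other_neq ue)) addbF.
  by move: Xe; rewrite (crossE _ ue); case: (u \in X); case: (_ \in X).
have fe : f != e by apply: contraFneq uf => ->.
move: uf; rewrite /inc => /negbT; rewrite negb_or ![u == _]eq_sym => /andP[pu qu].
by rewrite /cross !ZE //; apply: Xf'.
Qed.

(* Among the vertex sets crossed by a single separating edge, a smallest one
   contains no separating edge, so that parity makes its exit a leaf. *)
Lemma ex_separating_leaf s : link_connected s ->
  (forall e, e \notin s -> separating s e -> bridge s e) ->
  ~ uniform s ->
  exists u e, [/\ e \notin s, separating s e, inc u e &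
    forall f, f \notin s -> inc u f -> f = e].
Proof.
move=> conn bri nu; case: (ex_separating conn nu) => e0 e0s sep0.
pose P n := exists e (X : {set V}), [/\ e \notin s, separating s e, cross X e,
  forall f, f \notin s -> f != e -> ~~ cross X f & #|X| = n].
have [n] : exists n, P n.
  by case: (bri e0 e0s sep0) => X [Xe Xf]; exists #|X|, e0, X.
elim/ltn_ind: n => n IH [e [X [es sep Xe Xf Xn]]].
have [u [ue uX vX]] := crossP Xe.
set v := other e u in vX.
case: (classic (exists f, [/\ f \notin s, separating s f, p f \in X & q f \in X])).
  case=> f [fs sepf pfX qfX].
  have fe : f != e.
    by apply: contraTneq Xe => <-; rewrite /cross pfX qfX.
  have [Y0 [Yf0 Yg0]] := bri f fs sepf.
  have Ye0 : ~~ cross Y0 e by apply: Yg0; rewrite // eq_sym.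
  (* Complementing the cut if needed puts both ends of [e] outside [Y]. Then [f] alone crosses
     [X :&: Y], which is smaller than [X] as it lacks [u]. *)
  have [Y [Yf Yg uY vY]] : exists Y : {set V}, [/\ cross Y f,
      forall g, g \notin s -> g != f -> ~~ cross Y g, u \notin Y & v \notin Y].
    move: Ye0; rewrite (crossE _ ue) -/v; case uY: (u \in Y0) => /= vY.
      exists (~: Y0); rewrite !inE uY cross_setC; split=> // g gs gf.
        by rewrite cross_setC; apply: Yg0.
    by exists Y0; rewrite uY.
  apply: (IH #|X :&: Y|).
    rewrite -Xn; apply: proper_card; apply/properP; split; first exact: subsetIl.
    by exists u; rewrite // !inE (negbTE uY) andbF.
  exists f, (X :&: Y); split=> //.
    by move: Yf; rewrite /cross !inE pfX qfX.
  move=> g gs gf; case: (g =P e) => [->|/eqP ge].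
    by rewrite (crossE _ ue) !inE (negbTE uY) (negbTE vY) !andbF.
  move: (Xf g gs ge) (Yg g gs gf); rewrite /cross !inE.
  by case: (p g \in X) (q g \in X) (p g \in Y) (q g \in Y) => [] [] [] [].
move=> none; exists u, e; split=> //.
(* No remaining edge inside [X] separates, so [e] is still the only edge crossing this state class,
   on which the free colours agree. *)
pose X' := [set x in X | state s x == state s u].
apply: (@unique_cross_leaf s X') => //.
- move=> x y; rewrite !inE => /andP[_ /eqP xu] /andP[_ /eqP yu].
  by apply: state_free; rewrite xu.
- by rewrite (crossE _ ue) !inE uX (negbTE vX) eqxx.
- move=> f fs fe; have := Xf f fs fe.
  rewrite /cross !inE; case pX: (p f \in X); case qX: (q f \in X) => //= _.
  suff /eqP -> : state s (p f) == state s (q f) by rewrite addbb.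
  by apply: contraT => sepf; case: none; exists f.
- by rewrite inE uX eqxx.
Qed.

(** * Inserting a separating edge that is not a bridge *)

Lemma separating_rcons s e : link_connected s -> uniq s -> e \notin s ->
  separating s e -> ~ bridge s e ->
  [/\ link_connected (rcons s e), ~ uniform (rcons s e) & ~ trap (rcons s e)].
Proof.
move=> conn us es sep nb; split; first exact: link_connected_rcons_nonbridge.
all: have us' : uniq (rcons s e) by rewrite rcons_uniq es.
all: have liv v : inc v e -> live (rcons s e) v.
(* An end [v] with no edge left besides [e] would give the cut [[set v]], making [e] a bridge. *)
1,3: move=> ve; apply: NNPP => nl; apply: nb; exists [set v]; split.
1,3: by rewrite (crossE _ ve) !inE eqxx (negbTE (other_neq ve)).
1,2: move=> f fs fe; apply/negP => /crossP[x [xf]]; rewrite inE => /eqP xv _.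
1,2: by apply: nl; apply: (@live_inc _ _ f); rewrite -?xv // mem_rcons inE negb_or fe.
- move=> uni; move: sep; rewrite /separating.
  have := uni _ _ (liv _ (inc_p e)) (liv _ (inc_q e)).
  rewrite /state !label_rcons inc_p inc_q => -[-> /rcons_inj[->]].
  by rewrite eqxx.
move=> tr; have lp := liv _ (inc_p e); have lq := liv _ (inc_q e).
have [Spq szp tk] := tr _ _ lp lq; have [_ szq _] := tr _ _ lq lp.
move: sep lp lq szp szq tk; rewrite /separating /state !(live_size _ us').
rewrite !label_rcons inc_p inc_q !size_rcons -Spq.
have := notin_label es (inc_p e); have := notin_label es (inc_q e).
move: (label s (p e)) (label s (q e)) => a b nb' na sep lp lq szp szq.
(* Liveness and the trap bound leave two prefix lengths: the prefix stops just before or just after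
   [w e]. *)
have tkE (l : seq C) : (size l).+1 < #|palette (p e)| ->
    #|palette (p e)| <= (size l).+3 ->
    take (#|palette (p e)| - 2) (rcons l (w e)) = l \/
    take (#|palette (p e)| - 2) (rcons l (w e)) = rcons l (w e).
  move=> l1 l2; have [sz|sz] : #|palette (p e)| - 2 = size l \/
      #|palette (p e)| - 2 = size (rcons l (w e)) by rewrite size_rcons; lia.
    by left; rewrite sz -cats1 take_size_cat.
  by right; rewrite sz take_size.
(* Equal lengths give [a = b], so [e] would not separate; unequal ones put [w e] into a label of
   [s]. *)
case: (tkE a lp szp) (tkE b lq szq) => [] -> [] -> eqab.
- by rewrite eqab eqxx in sep.
- by case/negP: na; rewrite eqab mem_rcons mem_head.
- by case/negP: nb'; rewrite -eqab mem_rcons mem_head.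
- by case/rcons_inj: eqab => ab; rewrite ab eqxx in sep.
Qed.

(** * Inserting a pendant edge when all separating edges are bridges *)

Section PendantEdge.

Variables (s : seq E) (e : E) (u : V).
Hypotheses (conn : link_connected s) (us : uniq s).
Hypothesis bri : forall f, f \notin s -> separating s f -> bridge s f.
Hypotheses (es : e \notin s) (ue : inc u e).
Hypothesis only : forall f, f \notin s -> inc u f -> f = e.

Let v := other e u.
Let s' := rcons s e.

Let us' : uniq s'. Proof. by rewrite /s' rcons_uniq es. Qed.

Let ve : inc v e. Proof. exact: inc_other. Qed.

Let notin_s' f : f \notin s' = (f != e) && (f \notin s).
Proof. by rewrite /s' mem_rcons inE negb_or. Qed.

Let live_neq x : live s' x -> x != u.
Proof.
case/liveP=> f; rewrite notin_s' => /andP[fe fs] xf.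
by apply: contraNneq fe => xu; rewrite (only fs) // -xu.
Qed.

Let label'v : label s' v = rcons (label s v) (w e).
Proof. by rewrite /s' label_rcons ve. Qed.

Let label'E x : live s' x -> x != v -> label s' x = label s x.
Proof. by move=> /live_neq xu xv; apply: label_rcons_other ue _ _. Qed.

(** Let [h] remain at [v]. Its other end is untouched by [e], so before [e] the labels at the ends
    of [h] differ in length; thus [h] separates and is a bridge. After [e] the live vertices on the
    side of [v] have the same free colours, and parity makes [v] a leaf. *)
Lemma uniform_pendant : uniform s' -> live s' v ->
  #|palette v| = (size (label s' v)).+1.
Proof.
move=> uni lv; have [h hs' vh] := liveP _ _ lv.
have [he hs] : h != e /\ h \notin s by move: hs'; rewrite notin_s' => /andP[].
have yh := inc_other v h; have yv := other_neq vh.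
have ly := live_inc hs' yh.
have sep : separating s h.
  rewrite (separatingE _ vh) /state -(label'E ly yv); apply/eqP => -[_ lab].
  have [_ lab'] := uni _ _ lv ly.
  by move: lab; rewrite -lab' label'v => /(congr1 size); rewrite size_rcons; lia.
have [X0 [Xh0 Xg0]] := bri hs sep.
have [X [Xh Xg vX]] : exists X : {set V}, [/\ cross X h,
    forall g, g \notin s -> g != h -> ~~ cross X g & v \in X].
  case vX: (v \in X0); first by exists X0.
  exists (~: X0); rewrite cross_setC inE vX; split=> // g gs gh.
  by rewrite cross_setC; apply: Xg0.
apply: (size_leaf us' hs' vh).
pose Y := [set x in X | live s' x].
apply: (@unique_cross_leaf s' Y h v) => //.
- move=> x y; rewrite !inE => /andP[_ lx] /andP[_ ly'].
  exact/state_free/uni.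
- move: Xh; rewrite !(crossE _ vh) !inE vX lv /=.
  by case: (_ \in X).
- move=> g gs' gh; rewrite /cross !inE.
  rewrite (live_inc gs' (inc_p g)) (live_inc gs' (inc_q g)) !andbT.
  by apply: Xg => //; move: gs'; rewrite notin_s' => /andP[].
- by rewrite inE vX.
Qed.

Hypotheses (ntr : ~ trap s) (lv : live s' v) (tr : trap s').

Let k := #|palette v| - 2.

(** The label of [v] in [s'] contains [w e], and [v] is still live, so its palette has at least two
    colours and the subtraction in [k] is exact. *)
Let size_v : #|palette v| = k.+2 /\ (size (label s v) = k \/ (size (label s v)).+1 = k).
Proof.
have [_ sz _] := tr lv lv; move: lv sz; rewrite /k (live_size _ us') label'v size_rcons.
lia.
Qed.

Let trapE x : live s' x ->
  [/\ palette x = palette v, size (label s' x) = k \/ size (label s' x) = k.+1 &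
      take k (label s' x) = take k (label s' v)].
Proof.
move=> lx; have [pxv sz tk] := tr lx lv; split=> //.
by move: lx sz size_v.1; rewrite (live_size _ us') pxv; lia.
Qed.

(** With [u] fitting the prefix of [v], [s] itself would be a trap: the live vertices other than [u]
    and [v] stay live in [s'] and keep their labels, and the prefix at [v] ends before [w e]. *)
Let not_trap_u : palette u = palette v -> #|palette u| <= (size (label s u)).+2 ->
  take k (label s u) = take k (label s' v) -> size (label s v) = k -> False.
Proof.
move=> puv szu tku szv; apply: ntr.
have tkv : take k (label s' v) = label s v.
  by rewrite label'v -cats1 take_size_cat.
have all x : live s x -> [/\ palette x = palette v,
    #|palette x| <= (size (label s x)).+2 & take k (label s x) = label s v].
  move=> lx; case: (x =P u) => [->|/eqP xu]; first by rewrite -tkv.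
  case: (x =P v) => [->|/eqP xv].
    by rewrite size_v.1 szv take_oversize ?szv.
  have lx' : live s' x.
    have [f fs xf] := liveP _ _ lx; apply: (live_inc _ xf); rewrite notin_s' fs andbT.
    by apply: contraTneq xf => ->; rewrite (incE _ ue) negb_or xu.
  have [px sz tk] := trapE lx'; rewrite -(label'E lx' xv) tk tkv px size_v.1.
  by split=> //; case: sz => ->.
move=> x y /all[px szx tkx] /all[py _ tky]; split=> //; first by rewrite px.
by rewrite py tkx tky.
Qed.

(** The vertex found has one free colour left, so it is the leaf of a second pendant edge. Without
    it, all live vertices of [s'] other than [v] would carry the common prefix of length [k] as
    their whole label. *)
Lemma ex_second_leaf : exists x, [/\ live s' x, x != v & size (label s x) = k.+1].
Proof.
apply: NNPP => none.
have szx x : live s' x -> x != v -> size (label s' x) = k.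
  move=> lx xv; have [_ [//|sz] _] := trapE lx.
  by case: none; exists x; rewrite -(label'E lx xv).
have tkx x : live s' x -> x != v -> label s' x = take k (label s' v).
  move=> lx xv; have [_ _ <-] := trapE lx.
  by rewrite take_oversize // szx.
(* If the label of [v] in [s] has length [k], the live vertices of [s'] all have the state of [v] in
   [s], and only [e] leaves them; parity then leaves no edge but [e] at [v]. *)
have [szv|szv] := size_v.2.
  have tkv : take k (label s' v) = label s v.
    by rewrite label'v -cats1 take_size_cat.
  have [h hs' vh] := liveP _ _ lv.
  move: (hs'); rewrite notin_s' => /andP[he hs]; case/eqP: he.
  pose X := [set x | live s' x].
  have stX x : x \in X -> state s x = state s v.
    rewrite inE => lx; case: (x =P v) => [->//|/eqP xv].
    by have [px _ _] := trapE lx; rewrite /state px -(label'E lx xv) tkx // tkv.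
  apply: (@unique_cross_leaf s X e v) hs vh => //.
  - by move=> x y xX yX; apply: state_free; rewrite !stX.
  - rewrite (crossE _ ue) !inE -/v lv addbT.
    by apply/negP => /live_neq; rewrite eqxx.
  - move=> f fs fe; have fs' : f \notin s' by rewrite notin_s' fe.
    by rewrite /cross !inE (live_inc fs' (inc_p f)) (live_inc fs' (inc_q f)).
  - by rewrite inE.
(* Otherwise [e] brings the label of [v] up to the common prefix, so [s'] is uniform;
   [uniform_pendant] then leaves one colour at [v], against two by [size_v]. *)
have uni : uniform s'.
  have stv x : live s' x -> state s' x = state s' v.
    move=> lx; case: (x =P v) => [->//|/eqP xv].
    have [px _ _] := trapE lx; rewrite /state px tkx // take_oversize //.
    by rewrite label'v size_rcons szv.
  by move=> x y lx ly; rewrite !stv.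
have := uniform_pendant uni lv; rewrite label'v size_rcons szv size_v.1; lia.
Qed.

(** The edge [g] is the pendant edge at the second leaf [x]. Since [e] then remains, [u] and [v] are
    both live and can be compared after the insertion of [g]. *)
Lemma trap_pendant : exists2 g, g \notin s & [/\ separating s g,
  link_connected (rcons s g), ~ uniform (rcons s g) & ~ trap (rcons s g)].
Proof.
have [x [lx xv szx]] := ex_second_leaf; have xu := live_neq lx.
have [px _ _] := trapE lx.
have leafx : #|palette x| = (size (label s x)).+1 by rewrite px size_v.1 szx.
have [g gs' xg] := liveP _ _ lx.
have [ge gs] : g != e /\ g \notin s by move: gs'; rewrite notin_s' => /andP[].
have onlyx := leaf_size us gs xg leafx.
have zg := inc_other x g; set z := other g x in zg.
have zu : z != u by apply: contraNneq ge => zu; rewrite (only gs) // -zu.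
have lu_ f : f \notin s -> f != e -> ~~ inc u f.
  by move=> fs; apply: contra => uf; rewrite (only fs uf).
exists g => //.
have conn'' := link_connected_rcons_leaf conn gs xg onlyx.
(* With equal states [z] would be a leaf too, and [[set x; z]] would be cut off from the live vertex
   [u]. *)
have sep : separating s g.
  rewrite (separatingE _ xg) -/z; apply/eqP => st.
  have leafz : #|palette z| = (size (label s z)).+1.
    by move: leafx; case: st => -> ->.
  have onlyz := leaf_size us gs zg leafz.
  have : u \in [set x; z].
    apply: (conn _ (live_inc gs xg) (live_inc es ue)); last by rewrite !inE eqxx.
    move=> f fs; apply/negP => c; have [y [yf]] := crossP c.
    rewrite !inE => /orP[] /eqP yE; rewrite yE in yf.
      by rewrite (onlyx f fs yf) yE eqxx orbT.
    rewrite (onlyz f fs yf) yE.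
    have : inc (other g z) g by exact: inc_other.
    by rewrite (incE _ xg) => ->.
  by rewrite !inE eq_sym (negbTE xu) eq_sym (negbTE zu).
split=> //.
all: have us'' : uniq (rcons s g) by rewrite rcons_uniq gs.
all: have es'' : e \notin rcons s g by rewrite mem_rcons inE negb_or eq_sym ge.
all: have lu'' := live_inc es'' ue; have lv'' := live_inc es'' ve.
all: have labu : label (rcons s g) u = label s u
  by rewrite label_rcons (negbTE (lu_ _ gs ge)).
all: have tkv : size (label s v) = k ->
    take k (label (rcons s g) v) = take k (label s' v)
  by move=> szv; rewrite label'v label_rcons; case: ifP => _;
     rewrite -?cats1 !take_cat szv ltnn subnn ?take0 ?cats0 // -szv take_size.
- move=> uni; have [puv luv] := uni _ _ lu'' lv''; rewrite labu in luv.
  have szu := size_leaf us es ue only; rewrite puv size_v.1 in szu.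
  have [szv|szv] := size_v.2.
    apply: (not_trap_u puv _ _ szv); last by rewrite luv tkv.
    by rewrite puv size_v.1 szu.
  (* The leaf [u] would have a label of length [k.+1], but that of [v] has length at most [k]. *)
  move: szu szv; rewrite luv label_rcons; clear.
  by case: ifP => _; rewrite ?size_rcons; lia.
move=> tr''; have [puv szu tku] := tr'' _ _ lu'' lv''.
have [szv|szv] := size_v.2.
  apply: (not_trap_u puv _ _ szv); rewrite -labu //.
  by rewrite tku tkv.
have [_ szv'' _] := tr'' _ _ lv'' lv''.
(* The label of [v] is one short of [k]; only [g] ending at [v] can lengthen it enough for a
   trap. *)
have vg : inc v g.
  apply: contraLR szv''; rewrite label_rcons => /negbTE ->.
  by rewrite -ltnNge size_v.1; move: szv; clear; lia.
(* Three colours are free at [v]. The far end [y] of a third edge [h] is untouched by [e] and [g],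
   so its prefix of length [k] would end both in [w e] and in [w g]. *)
have [h [hs vh he hg]] : exists h, [/\ h \notin s, inc v h, h != e & h != g].
  have /subsetPn[h] : ~~ (remaining s v \subset [set e; g]).
    apply/negP => /subset_leq_card; have := card_palette v us.
    by rewrite size_v.1 cards2; move: szv; clear; case: (e != g); lia.
  by rewrite !inE negb_or => /andP[hs vh] /andP[he hg]; exists h.
have yh := inc_other v h; set y := other h v in yh.
have yv : y != v := other_neq vh.
have hs' : h \notin s' by rewrite notin_s' he.
have ly := live_inc hs' yh.
have yx : y != x by apply: contraNneq hg => yx; rewrite (onlyx h) // -yx.
have hs'' : h \notin rcons s g by rewrite mem_rcons inE negb_or hg.
have [_ _ tky] := tr'' _ _ (live_inc hs'' yh) lv''.
have [_ _ tky'] := trapE ly.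
have vz : v = z by move: vg; rewrite (incE _ xg) eq_sym (negbTE xv) => /eqP.
have tk_rcons c : take k (rcons (label s v) c) = rcons (label s v) c.
  by rewrite take_oversize // size_rcons szv.
move: tky; rewrite -/k (label_rcons_other s xg yx) -?/z -?vz //.
rewrite -(label'E ly yv) tky' label_rcons vg label'v !tk_rcons => /rcons_inj[we].
by move: ge; rewrite (w_proper ve vg we) eqxx.
Qed.

End PendantEdge.

(** * Completing the order *)

Lemma ex_insertion s : uniq s -> link_connected s -> ~ uniform s -> ~ trap s ->
  exists2 e, e \notin s & separating s e /\
    ((forall f, f \in rcons s e) \/
     [/\ link_connected (rcons s e), ~ uniform (rcons s e) & ~ trap (rcons s e)]).
Proof.
move=> us conn nu ntr.
case: (classic (exists e, [/\ e \notin s, separating s e & ~ bridge s e])).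
  case=> e [es sep nb]; exists e => //; split=> //; right.
  exact: separating_rcons.
move=> none.
have bri e : e \notin s -> separating s e -> bridge s e.
  by move=> es sep; apply: NNPP => nb; apply: none; exists e.
have [u [e [es sep ue only]]] := ex_separating_leaf conn bri nu.
case: (classic (forall f, f \in rcons s e)) => [all|nall].
  by exists e => //; split=> //; left.
have conn' := link_connected_rcons_leaf conn es ue only.
have us' : uniq (rcons s e) by rewrite rcons_uniq es.
(* If nothing but [e] remained at its other end, connectedness would make [e] the last edge. *)
have lv : live (rcons s e) (other e u).
  apply: contraT => nlv; case: nall => f; apply: contraT => fs'.
  have vonly g : g \notin s -> inc (other e u) g -> g = e.
    move=> gs vg; apply/eqP; apply: contraT => ge; case/negP: nlv.
    by apply: live_inc vg; rewrite mem_rcons inE negb_or ge.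
  have fs : f \notin s by move: fs'; rewrite mem_rcons inE negb_or => /andP[].
  have fe : f != e by move: fs'; rewrite mem_rcons inE negb_or => /andP[].
  have : p f \in [set u; other e u].
    apply: (conn _ _ _ _ (live_inc es ue) (live_inc fs (inc_p f))); last by rewrite !inE eqxx.
    move=> g gs; apply/negP => c; have [y [yg yX]] := crossP c.
    have ge : g = e by move: yX yg; rewrite !inE => /orP[] /eqP ->; [exact: only|exact: vonly].
    by move: c; rewrite ge (crossE _ ue) !inE !eqxx orbT.
  by rewrite !inE => /orP[] /eqP pE; move: fe (inc_p f); rewrite pE => fe fi;
    rewrite ?(only f fs fi) ?(vonly f fs fi) eqxx in fe.
case: (classic (trap (rcons s e))) => tr.
  have [g gs [sepg gr1 gr2 gr3]] := trap_pendant conn us bri es ue only ntr lv tr.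
  by exists g => //; split=> //; right.
(* A uniform remainder is a trap, since [uniform_pendant] leaves only one free colour at each live
   vertex. *)
exists e => //; split=> //; right; split=> // uni; apply: tr => x y lx ly.
have sz := uniform_pendant us bri es ue only uni lv.
have [pxv lxv] := uni _ _ lx lv.
have [pxy lxy] := uni _ _ lx ly.
by rewrite -pxy lxy; split=> //; rewrite -lxy lxv pxv sz.
Qed.

(* The colour of [e] occurs only once in each of the sequences of its two
   endpoints, right after the labels that its insertion has found there. *)
Lemma separating_final s e s2 : uniq (s ++ e :: s2) ->
  (forall f, f \in s ++ e :: s2) -> separating s e ->
  label (s ++ e :: s2) (p e) != label (s ++ e :: s2) (q e).
Proof.
rewrite cat_uniq /= negb_or => /and3P[us /andP[es _] _] all sep.
set sf := s ++ _ in all *.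
have labE v : inc v e -> label sf v = label s v ++ w e :: label s2 v.
  by move=> ve; rewrite /label /sf filter_cat /= ve map_cat.
have palE v : palette v =i label sf v.
  move=> c; apply/imsetP/mapP => -[f].
    by rewrite inE => vf ->; exists f; rewrite // mem_filter vf all.
  by rewrite mem_filter => /andP[vf _] ->; exists f; rewrite // inE.
have idx v : inc v e -> index (w e) (label sf v) = size (label s v).
  move=> ve; rewrite labE // index_cat (negbTE (notin_label es ve)) /= eqxx.
  by rewrite addn0.
apply: contra sep => /eqP lab; rewrite /state; apply/eqP.
congr pair; first by apply/setP => c; rewrite !palE lab.
have szE : size (label s (p e)) = size (label s (q e)).
  by rewrite -!idx ?inc_p ?inc_q // lab.
move/eqP: lab; rewrite !labE ?inc_p ?inc_q // eqseq_cat //.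
by case/andP=> /eqP.
Qed.

(** The claim covers only the edges added to [s], so the induction on the number of missing edges
    can pass to any admissible [s]. *)
Lemma ex_complete_order s : uniq s -> link_connected s -> ~ uniform s -> ~ trap s ->
  exists2 s2, uniq (s ++ s2) /\ (forall e, e \in s ++ s2) &
    forall e, e \in s2 -> label (s ++ s2) (p e) != label (s ++ s2) (q e).
Proof.
have [n] := ubnP (#|E| - size s); elim: n s => // n IH s lt us conn nu ntr.
have [e es [sep fin]] := ex_insertion us conn nu ntr.
have us' : uniq (rcons s e) by rewrite rcons_uniq es.
case: fin => [all|[conn' nu' ntr']].
  exists [:: e]; rewrite ?cats1 //.
  move=> f; rewrite inE => /eqP ->; rewrite -cats1; apply: separating_final => //.
    by rewrite cats1.
  by move=> g; rewrite cats1.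
have [|s2 [us2 all] Ps2] := IH (rcons s e) _ us' conn' nu' ntr'.
  have : size (rcons s e) <= #|E|.
    by rewrite -(card_uniqP us') max_card.
  move: lt; clear; rewrite size_rcons; lia.
rewrite cat_rcons in us2 all Ps2; exists (e :: s2) => // f.
rewrite inE => /orP[/eqP -> |/Ps2 //]; exact: separating_final.
Qed.

Lemma ex_order :
  (forall X : {set V}, (forall e, ~~ cross X e) ->
    forall u v, u \in X -> v \in X) ->
  (exists e f, palette (p e) != palette (p f)) ->
  exists s, [/\ uniq s, forall e, e \in s &
    forall e, label s (p e) != label s (q e)].
Proof.
move=> conn [e [f pef]].
have nu : ~ uniform [::].
  have lp g : live [::] (p g) by apply: live_inc (inc_p g).
  by move=> uni; case/eqP: pef; case: (uni _ _ (lp e) (lp f)).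
(* All labels are empty at the start, so a trap has equal palettes and is uniform. *)
have ntr : ~ trap [::].
  move=> tr; apply: nu => u v lu lv; rewrite /state.
  by have [-> _ _] := tr u v lu lv.
have [|s [us all] Ps] := @ex_complete_order [::] isT _ nu ntr.
  move=> X Xe u v _ _; apply: conn => g; exact: Xe.
by exists s; split=> // g; apply: Ps.
Qed.

End EdgeInsertion.

(** * From edge lists to graphs *)

(** Each colour is replaced by its colour class; this reduces an arbitrary type of colours to a
    finite one. *)
Lemma ex_finite_colour (E : finType) (C : Type) (w : E -> C) :
  exists c : E -> {set E}, forall a b, c a = c b <-> w a = w b.
Proof.
have ex a : exists X : {set E}, forall b, b \in X <-> w b = w a.
  have [d dP] : exists d : E -> bool, forall b, d b <-> w b = w a.
    apply: (@fin_all_exists _ _ (fun b (x : bool) => x <-> w b = w a)) => b.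
    by case: (classic (w b = w a)) => ab; [exists true | exists false].
  by exists [set b | d b] => b; rewrite inE.
have [c cP] := fin_all_exists ex; exists c => a b; split=> [cab|wab].
  by apply/cP; rewrite -cab; apply/cP.
by apply/setP => x; apply/idP/idP => /cP xE; apply/cP; rewrite xE.
Qed.

Lemma map_eq_fibre (A B D : Type) (f : A -> B) (g : A -> D) (s1 s2 : seq A) :
  (forall a b, f a = f b -> g a = g b) -> map f s1 = map f s2 -> map g s1 = map g s2.
Proof.
move=> fg; elim: s1 s2 => [|a s1 IH] [|b s2] //= [/fg -> /IH ->] //.
Qed.

Lemma ex_ends (G : sgraph) : exists p q : edge G -> G,
  forall a, val a = [set p a; q a] /\ adj (p a) (q a).
Proof.
have ex (a : edge G) : exists xy : G * G, val a = [set xy.1; xy.2] /\ adj xy.1 xy.2.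
  case: a => a /= /imset2P[x y _]; rewrite inE => xy ->.
  by exists (x, y).
have [f fP] := fin_all_exists ex.
by exists (fun a => (f a).1), (fun a => (f a).2).
Qed.

Lemma edges_adj (G : sgraph) (u v : G) : adj u v -> [set u; v] \in edges G.
Proof. by move=> uv; apply/imset2P; exists u v; rewrite ?inE. Qed.

Definition index_le (E : eqType) (s : seq E) : rel E :=
  fun a b => index a s <= index b s.

Lemma index_le_total_order (E : eqType) (s : seq E) :
  (forall e, e \in s) -> total_order (index_le s).
Proof.
move=> all; split.
- by move=> a; apply: leqnn.
- by move=> a b /anti_leq; apply: index_inj.
- by move=> b a c; apply: leq_trans.
- by move=> a b; apply: leq_total.
Qed.

(** This brings [induced_colour] for the order of [s] into the filtered form of [label]. *)
Lemma sort_index_le (E : finType) (s : seq E) (A : {set E}) :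
  uniq s -> (forall e, e \in s) ->
  sort (index_le s) (enum A) = [seq e <- s | e \in A].
Proof.
move=> us all; have [_ anti tr tot] := index_le_total_order all.
apply: (sorted_eq tr anti); first exact: sort_sorted.
  apply: sorted_filter => //; case: s us {all anti tr tot} => // x s.
  move=> us; apply/(pathP x) => i lt; rewrite /index_le.
  by rewrite -[nth x s i]/(nth x (x :: s) i.+1) !index_uniq //=; lia.
rewrite perm_sort; apply: uniq_perm; rewrite ?enum_uniq ?filter_uniq //.
by move=> e; rewrite mem_enum mem_filter all andbT.
Qed.

Theorem corollary7 (G : sgraph) (hconn : connected G) (h2 : class_two G)
    (C : Type) (w : edge G -> C) (hw : proper_edge_colouring w) :
  sequentially_orderable w.
Proof.
have [c cP] := ex_finite_colour w.
have [p [q ends]] := ex_ends G.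
have incidentE v (a : edge G) : incident v a = inc p q v a.
  by rewrite /incident (ends a).1 !inE.
have neq_ends a : p a != q a.
  by apply: contraTneq (ends a).2 => ->; rewrite adj_irrefl.
have c_proper v a b : inc p q v a -> inc p q v b -> c a = c b -> a = b.
  rewrite -!incidentE => va vb /cP wab; apply/eqP; apply: contraT => ab.
  by case: (hw a b ab _ wab); apply/existsP; exists v; rewrite va.
(* As [G] is simple, the edges at [v] inject into its neighbours; this bounds a palette by a
   degree. *)
have edge_inj v a b : inc p q v a -> inc p q v b ->
    other p q a v = other p q b v -> a = b.
  have val_ends v' d : inc p q v' d -> val d = [set v'; other p q d v'].
    by move=> vd; apply/setP => x; rewrite (ends d).1 !inE -(incE x vd).
  move=> va vb o; apply: val_inj.
  by rewrite (val_ends v a) // (val_ends v b) // o.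
have conn (X : {set G}) : (forall e, ~~ cross p q X e) ->
    forall u v, u \in X -> v \in X.
  move=> Xe u v uX; have /connectP[r] := hconn u v.
  elim: r u uX => [|y r IH] u uX /= => [_ -> //|/andP[uy] pr lr].
  have yu : y != u by apply: contraTneq uy => ->; rewrite adj_irrefl.
  apply: IH pr lr; have := Xe (Sub [set u; y] (edges_adj uy)).
  set a := Sub _ _; have ua : inc p q u a by rewrite -incidentE /incident /a /= !inE eqxx.
  have ya : inc p q y a by rewrite -incidentE /incident /a /= !inE eqxx orbT.
  move: ya; rewrite (incE y ua) (negbTE yu) (crossE _ ua) uX => /eqP <-.
  by rewrite negbK.
(* Otherwise one palette [P] contains the colour of every edge, and renumbering the colours in [P]
   gives a proper edge colouring with at most [max_degree G] colours, against class two. *)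
have [e [f pef]] : exists e f, palette p q c (p e) != palette p q c (p f).
  apply: NNPP => const.
  have pal a b : palette p q c (p a) = palette p q c (p b).
    by apply/eqP; apply: contraT => ab; case: const; exists a, b.
  have : chromatic_index G <= max_degree G; last by rewrite h2 ltnn.
  rewrite /chromatic_index; case: ex_minnP => m _; apply.
  case: (pickP (@predT (edge G))) => [e0 _|none]; last first.
    (* Without edges there is no palette to take, but the empty colouring suffices. *)
    have empty (a : edge G) : False by have := none a.
    apply/edge_colourableP; exists (fun a => False_rect _ (empty a)) => a.
    by case: (empty a).
  set P := palette p q c (p e0).
  have cP' a : c a \in P.
    rewrite /P -(pal a); apply/imsetP; exists a => //.
    by rewrite inE inc_p.
  have le : #|P| <= max_degree G.
    apply: leq_trans (leq_bigmax (p e0)); apply: leq_trans (leq_imset_card _ _) _.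
    rewrite -(card_in_imset (f := fun a => other p q a (p e0))); last first.
      by move=> a b; rewrite !inE; apply: edge_inj.
    apply: subset_leq_card; apply/subsetP => x /imsetP[a]; rewrite !inE => ia ->.
    have [_] := ends a; move: ia; rewrite /inc /other; case: eqP => [-> //|_ /= /eqP ->].
    by rewrite adj_sym.
  apply/edge_colourableP.
  exists (fun a => widen_ord le (enum_rank_in (cP' e0) (c a))) => a b ab sab.
  move/(congr1 val) => /= /val_inj /(enum_rank_in_inj (cP' a) (cP' b)) /cP.
  exact: hw.
have [s [us all Ps]] := ex_order neq_ends c_proper conn (ex_intro _ e (ex_intro _ f pef)).
exists (index_le s); first exact: index_le_total_order.
move=> u v uv; rewrite /induced_colour !sort_index_le // => eqw.
have vu : v != u by apply: contraTneq uv => ->; rewrite adj_irrefl.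
set a : edge G := Sub [set u; v] (edges_adj uv).
have lab x : label p q c s x = map c [seq e <- s | e \in [set a | incident x a]].
  by congr map; apply: eq_filter => d; rewrite inE incidentE.
have luv : label p q c s u = label p q c s v.
  rewrite !lab; apply: map_eq_fibre eqw => d d' ww; exact/cP.
have ua : inc p q u a by rewrite -incidentE /incident /a /= !inE eqxx.
have va : inc p q v a by rewrite -incidentE /incident /a /= !inE eqxx orbT.
move: vu ua va (Ps a); rewrite /inc => vu /orP[] /eqP ua /orP[] /eqP va.
- by rewrite ua va eqxx in vu.
- by rewrite -ua -va luv eqxx.
- by rewrite -ua -va luv eqxx.
- by rewrite ua va eqxx in vu.
Qed.
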